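(* Let $\Sigma$ and $\widetilde\Sigma$ be finite alphabets, let $X\subset\Sigma^{\mathbb Z}$ and $\widetilde X\subset\widetilde\Sigma^{\mathbb Z}$ be topologically conjugate subshifts, and let $\widetilde X$ have property $(D)$. Then $X$ also has property $(D)$.
   Context: A subshift $X\subset\Sigma^{\mathbb Z}$ over a finite alphabet is a closed shift-invariant set; a finite word is admissible if it appears in a point of $X$. Two subshifts are topologically conjugate if there is a shift-commuting homeomorphism between them. For an interval $I$ of integers, $X_I=\{(x_j)_{j\in I}:x\in X\}$. For a word $a\in X_{(-k,0]}$, $\omega_1^+(a)$ is the set of $\sigma\in\Sigma$ such that $(y^-,a,\sigma)\in X_{(-\infty,1]}$ for all $y^-\in X_{(-\infty,-k]}$ with $(y^-,a)\in X_{(-\infty,0]}$ (words are considered up to translation of indices). For a word $b$, $\Gamma^-(b)$ is the set of words $a$ such that $ab$ is admissible. A subshift $X$ has property $(D)$ if for all admissible words $b\sigma$ of $X$ ($b$ a word, $\sigma\in\Sigma$) there exists a word $a\in\Gamma^-(b)$ such that $\sigma\in\omega_1^+(ab)$. *)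

(* Defs.v *)
From HB Require Import structures.
From mathcomp Require Import all_boot all_order all_algebra.
From mathcomp Require Import all_classical all_reals all_analysis.

Set Implicit Arguments.
Unset Strict Implicit.
Unset Printing Implicit Defensive.

Import Order.TTheory GRing.Theory Num.Theory.
Local Open Scope classical_set_scope.
Local Open Scope ring_scope.

Definition full_shift (Sigma : finType) : Type :=
  {ptws int -> discrete_topology Sigma}.

HB.instance Definition _ (Sigma : finType) :=
  Topological.copy (full_shift Sigma) {ptws int -> discrete_topology Sigma}.

Definition shift (Sigma : finType) (x : full_shift Sigma) : full_shift Sigma :=
  fun i : int => x (i + 1).

Definition subshift (Sigma : finType) (X : set (full_shift Sigma)) : Prop :=
  closed X /\ @shift Sigma @` X = X.

(* Subshifts are coerced to the subtypes [set_type X] and [set_type Y], which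
   carry the topology induced from the full shifts. *)
Definition conjugate (Sigma Sigma' : finType)
    (X : set (full_shift Sigma)) (Y : set (full_shift Sigma')) : Prop :=
  exists (phi : X -> Y) (psi : Y -> X),
    [/\ continuous phi, continuous psi, cancel phi psi, cancel psi phi &
        forall x x' : X, set_val x' = shift (set_val x) ->
          set_val (phi x') = shift (set_val (phi x))].

Definition restr (Sigma : finType) (I : interval int) (x : full_shift Sigma) :
    {j : int | j \in I} -> Sigma :=
  fun j => x (sval j).

(* The set written $X_I$. *)
Definition block (Sigma : finType) (X : set (full_shift Sigma))
    (I : interval int) : set ({j : int | j \in I} -> Sigma) :=
  restr (I := I) @` X.

(* The word x_i x_{i+1} ... x_{i+n-1}; as a sequence it forgets its position,
   so that words are taken up to translation of the indices. *)
Definition word_at (Sigma : finType) (x : full_shift Sigma) (i : int) (n : nat)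
    : seq Sigma :=
  mkseq (fun j => x (i + j%:Z)) n.

Definition admissible (Sigma : finType) (X : set (full_shift Sigma))
    (w : seq Sigma) : Prop :=
  exists2 x, X x & exists i : int, word_at x i (size w) = w.

Definition Gamma_minus (Sigma : finType) (X : set (full_shift Sigma))
    (b : seq Sigma) : set (seq Sigma) :=
  [set a | admissible X (a ++ b)].

(* With k = size a, the triple (y^-, a, sigma) indexed by ]-oo, 1] is given by
   the restriction of a configuration z to ]-oo, 1]: y^- is z on ]-oo, -k], the
   word a is z on ]-k, 0], sigma is z 1. The values of z beyond 1 play no
   role. *)
Definition omega_plus (Sigma : finType) (X : set (full_shift Sigma))
    (a : seq Sigma) : set Sigma :=
  [set sigma | forall z : full_shift Sigma,
     word_at z (1 - (size a)%:Z) (size a) = a ->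
     z 1 = sigma ->
     block X (restr (I := `]-oo, (- (size a)%:Z)]) z) ->
     block X (restr (I := `]-oo, 0]) z) ->
     block X (restr (I := `]-oo, 1]) z)].

Definition property_D (Sigma : finType) (X : set (full_shift Sigma)) : Prop :=
  forall (b : seq Sigma) (sigma : Sigma),
    admissible X (rcons b sigma) ->
    exists2 a, Gamma_minus X b a & omega_plus X (a ++ b) sigma.

(* Main.v *)
Require Import Defs.
From mathcomp Require Import all_boot all_order all_algebra.
From mathcomp Require Import all_classical all_reals all_analysis.
From mathcomp Require Import zify.
Set Implicit Arguments.
Unset Strict Implicit.
Unset Printing Implicit Defensive.
Import Order.TTheory GRing.Theory Num.Theory.
Local Open Scope classical_set_scope.
Local Open Scope ring_scope.

(** Write L for a common window size of the two mutually inverse block codes.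
Property (D) extends from letters to words by induction: if bc is admissible
in X', some admissible ab is such that every left-infinite past ending in ab
can be followed by c. Given b sigma in a point x of X, with b on [0, m[ and
sigma at m, apply this in X' to the words b' and c' read off the image x' of x
on [-3L, m-L[ and [m-L, m+L], which gives a'. Let z' in X' contain a'b'c', and
let a be the word preceding b in the preimage z of z', long enough for ab to
determine a'b'. If y in X ends in ab, its image reads a'b' just before m-L,
hence can be modified from there on so as to read c'. The preimage of the
result agrees with y left of m-2L and with x on [-2L, m], hence with y up to
m-1, and it has sigma at m. *)

(** * Topology of the full shift: finite windows and compactness *)

Definition agree_on (S : finType) (n : nat) (x y : full_shift S) : Prop :=
  forall j : int, - n%:Z <= j <= n%:Z -> x j = y j.

Lemma nbhs_agree_on (S : finType) (n : nat) (x : full_shift S) :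
  nbhs x [set y | agree_on n x y].
Proof.
have near_coord j : \forall y \near x, y j = x j.
  exact: (@proj_continuous int (fun=> discrete_topology S) j x _
    (discrete_set1 _)).
elim: n => [|n IHn].
  apply: filterS (near_coord 0) => y /= yx j hj.
  by have -> : j = 0 by lia.
apply: filterS3 IHn (near_coord n.+1%:Z) (near_coord (- n.+1%:Z)).
move=> y /= IH y1 y2 j hj.
have [->//|jn1] := eqVneq j n.+1%:Z.
have [->//|jn2] := eqVneq j (- n.+1%:Z).
by apply: IH; lia.
Qed.

(** The filter generated by the sets of points agreeing with [x] on [-n, n] converges to [x] in each
    coordinate, hence in the product topology. *)
Lemma agree_on_nbhs (S : finType) (x : full_shift S) (A : set (full_shift S)) :
  nbhs x A -> exists n, [set y | agree_on n x y] `<=` A.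
Proof.
pose F := filter_from [set: nat]
  (fun n => [set y : full_shift S | agree_on n x y]).
have FF : Filter F.
  apply: filter_from_filter; first by exists 0%N.
  move=> m n _ _; exists (maxn m n) => // y xy; split=> j hj; apply: xy; lia.
have Fx : F --> x.
  (* [pointwise_cvgP] wants a topology on the index type; any one will do. *)
  apply/(@pointwise_cvgP (discrete_topology int) (discrete_topology S) F x) => j.
  apply/discrete_cvg; exists `|j|%N => // y xy /=.
  by rewrite -xy //; lia.
by move=> /Fx [n _]; exists n.
Qed.

Lemma compact_full_shift (S : finType) : compact [set: full_shift S].
Proof.
have := @tychonoff int (fun=> discrete_topology S) (fun=> setT).
move=> /(_ _)/=.
have -> : [set f : int -> discrete_topology S | int -> True] = setT.
  by rewrite predeqE.
apply=> _; exact/finite_compact/(@finite_finset S).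
Qed.

(** Coordinate 0 of [f] takes values in a discrete space, so it is constant on a cylinder around
    each point; compactness of [X] makes the window uniform. *)
Lemma continuous_local (S S' : finType) (X : set (full_shift S))
    (Y : set (full_shift S')) (f : X -> Y) :
  closed X -> continuous f ->
  exists n, forall u v : X, agree_on n (set_val u) (set_val v) ->
    set_val (f u) 0 = set_val (f v) 0.
Proof.
move=> clX fc.
have cX : compact X by apply: subclosed_compact clX (@compact_full_shift S) _.
(* Compactness of [X] speaks of points of the full shift, so [P] is a predicate there and quantifies
   over the lifts [u] of [x]. *)
pose P n x := forall u v : X, set_val u = x -> agree_on n x (set_val v) ->
  set_val (f u) 0 = set_val (f v) 0.
have local_const (u : X) : exists n, forall v : X,
    agree_on n (set_val u) (set_val v) ->
    set_val (f v) 0 = set_val (f u) 0.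
  have cf : {for u, continuous
      (fun v => set_val (f v) 0 : discrete_topology S')}.
    apply: (@continuous_comp _ _ _ f
      (fun v : Y => set_val v 0 : discrete_topology S')); first exact: fc.
    apply: (@continuous_comp _ _ _ set_val
      (fun y : full_shift S' => y 0 : discrete_topology S')).
      exact: initial_continuous.
    exact: (@proj_continuous int (fun=> discrete_topology S')).
  have := cf _ (discrete_set1 _).
  (* Open sets of the subtype are traces of open sets [B] of the full shift. *)
  case=> _ [[B oB <-] /= Bu sub].
  have [n nB] := agree_on_nbhs (open_nbhs_nbhs (conj oB Bu)).
  by exists n => v uv; apply: sub; apply: nB.
suff [N _ PN] : \forall n \near \oo, X `<=` P n.
  exists N => u v uv.
  by apply: (PN N _ (set_val u)) => //=; apply: set_valP.
move/compact_near_coveringP: cX; apply => x Xx.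
have [u ux] : exists u : X, set_val u = x by exists (SigSub (mem_set Xx)).
have [n nu] := local_const u.
exists ([set y | agree_on n x y], [set m | (n <= m)%N]).
  by split; [exact: nbhs_agree_on|exists n].
move=> [y m] /= [xy nm] u' v u'y yv.
rewrite !nu // ux => j hj; last by rewrite xy ?u'y.
by rewrite xy // yv //; lia.
Qed.

(** * Shift invariance and sliding block codes *)

Definition translate (S : finType) (k : int) (x : full_shift S) : full_shift S :=
  fun i => x (i + k).

Lemma subshift_translate (S : finType) (X : set (full_shift S)) (k : int) x :
  subshift X -> X x -> X (translate k x).
Proof.
move=> [_ sX] Xx.
have tS y m n : translate m (translate n y) = translate (m + n) y :> full_shift S.
  by apply/funext => i; rewrite /translate addrA.
have shiftX y : X y -> X (translate 1 y) by move=> Xy; rewrite -sX; exists y.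
(* As [X] is contained in its image under the shift, [y] is the shift of some [z] in [X], and this
   [z] is the inverse shift of [y]. *)
have unshiftX y : X y -> X (translate (-1) y).
  rewrite -{1}sX => -[z Xz <-].
  suff -> : translate (-1) (Defs.shift z) = z by [].
  by apply/funext => i; rewrite /translate /Defs.shift subrK.
elim: k => [|n IH|n IH].
- suff -> : translate 0 x = x by [].
  by apply/funext => i; rewrite /translate addr0.
- by rewrite intS -tS; apply: shiftX.
- by rewrite intS opprD -tS; apply: unshiftX.
Qed.

Lemma set_val_surj (T : Type) (A : set T) (x : T) :
  A x -> exists u : A, set_val u = x.
Proof. by move=> Ax; exists (SigSub (mem_set Ax)). Qed.

Lemma translate_lift (S : finType) (X : set (full_shift S)) (k : int) (u : X) :
  subshift X -> exists v : X, set_val v = translate k (set_val u).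
Proof.
move=> sX; apply: set_val_surj; apply: (subshift_translate _ sX).
exact: set_valP.
Qed.

Lemma commute_translate (S S' : finType) (X : set (full_shift S))
    (Y : set (full_shift S')) (f : X -> Y) (k : int) (u v : X) :
  subshift X ->
  (forall u v : X, set_val v = Defs.shift (set_val u) ->
     set_val (f v) = Defs.shift (set_val (f u))) ->
  set_val v = translate k (set_val u) ->
  set_val (f v) = translate k (set_val (f u)).
Proof.
move=> sX fC.
have fN (n : nat) (u0 v0 : X) : set_val v0 = translate n%:Z (set_val u0) ->
    set_val (f v0) = translate n%:Z (set_val (f u0)).
  elim: n v0 => [|n IH] v0 v0E.
    suff -> : v0 = u0 by apply/funext => i; rewrite /translate addr0.
    apply/val_inj; rewrite -!set_valE v0E.
    by apply/funext => i; rewrite /translate addr0.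
  have [w wE] := translate_lift n%:Z u0 sX.
  rewrite (fC w) ?(IH w) //.
    by apply/funext => i; rewrite /translate /Defs.shift -addrA -intS.
    by rewrite v0E wE; apply/funext => i;
    rewrite /translate /Defs.shift -addrA -intS.
case: k => n; first exact: fN.
(* A negative translation from [u] to [v] is a positive one from [v] to [u]. *)
rewrite NegzE => vE; rewrite (fN n.+1 v u).
  by apply/funext => i; rewrite /translate addrNK.
by rewrite vE; apply/funext => i; rewrite /translate addrK.
Qed.

(* The Curtis-Hedlund-Lyndon theorem. *)
Lemma sliding_block_code (S S' : finType) (X : set (full_shift S))
    (Y : set (full_shift S')) (f : X -> Y) :
  subshift X -> continuous f ->
  (forall u v : X, set_val v = Defs.shift (set_val u) ->
     set_val (f v) = Defs.shift (set_val (f u))) ->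
  exists n : nat, forall (u v : X) (i : int),
    (forall j : int, i - n%:Z <= j <= i + n%:Z -> set_val u j = set_val v j) ->
    set_val (f u) i = set_val (f v) i.
Proof.
move=> sX fc fC; have [n fn] := continuous_local sX.1 fc.
exists n => u v i uv.
have [[u' u'E] [v' v'E]] := (translate_lift i u sX, translate_lift i v sX).
have tE w w' : set_val w' = translate i (set_val w) ->
    set_val (f w) i = set_val (f w') 0.
  by move=> /(commute_translate sX fC) ->; rewrite /translate add0r.
rewrite (tE _ _ u'E) (tE _ _ v'E); apply: fn => j hj; rewrite u'E v'E.
by apply: uv; lia.
Qed.

(** * Words and their occurrences *)

Definition occurs_at (S : finType) (w : seq S) (x : full_shift S) (i : int) : Prop :=
  word_at x i (size w) = w.

Lemma eq_word_at (S : finType) (x y : full_shift S) (i j : int) (n : nat) :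
  word_at x i n = word_at y j n <->
  forall k : nat, (k < n)%N -> x (i + k%:Z) = y (j + k%:Z).
Proof.
split=> [xy k kn|xy]; last first.
  by apply/eq_in_map => k; rewrite mem_iota => kn; apply: xy.
have := congr1 (fun w => nth (x 0) w k) xy.
by rewrite !nth_mkseq.
Qed.

Lemma word_at_agree (S : finType) (x y : full_shift S) (i : int) (n : nat) :
  word_at x i n = word_at y i n <->
  forall j : int, i <= j < i + n%:Z -> x j = y j.
Proof.
rewrite eq_word_at; split=> xy j jn; last by apply: xy; lia.
have -> : j = i + `|j - i|%N%:Z by lia.
by apply: xy; lia.
Qed.

Lemma word_at_cat (S : finType) (x : full_shift S) (i : int) (m n : nat) :
  word_at x i (m + n) = word_at x i m ++ word_at x (i + m%:Z) n.
Proof.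
rewrite /word_at /mkseq iotaD map_cat add0n; congr (_ ++ _).
rewrite -[in LHS](addn0 m) iotaDl -map_comp.
by apply: eq_map => k /=; rewrite PoszD addrA.
Qed.

Lemma word_at_translate (S : finType) (x : full_shift S) (i k : int) (n : nat) :
  word_at (translate k x) i n = word_at x (i + k) n.
Proof. by apply/eq_word_at => j _; rewrite /translate addrAC. Qed.

Lemma size_word_at (S : finType) (x : full_shift S) (i : int) (n : nat) :
  size (word_at x i n) = n.
Proof. by rewrite size_mkseq. Qed.

Lemma occurs_at_cat (S : finType) (v w : seq S) (x : full_shift S) (i : int) :
  occurs_at (v ++ w) x i <->
  occurs_at v x i /\ occurs_at w x (i + (size v)%:Z).
Proof.
rewrite /occurs_at size_cat word_at_cat; split=> [/eqP|[-> ->] //].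
by rewrite eqseq_cat ?size_word_at // => /andP[/eqP-> /eqP->].
Qed.

Lemma occurs_at1 (S : finType) (s : S) (x : full_shift S) (i : int) :
  occurs_at [:: s] x i <-> x i = s.
Proof.
by rewrite /occurs_at /word_at /mkseq /= addr0; split=> [[]|->].
Qed.

Lemma occurs_at_word_at (S : finType) (x y : full_shift S) (i : int) (n : nat) :
  occurs_at (word_at x i n) y i <->
  forall j : int, i <= j < i + n%:Z -> y j = x j.
Proof. by rewrite /occurs_at size_word_at word_at_agree. Qed.

Lemma admissible_at (S : finType) (X : set (full_shift S)) (w : seq S) (i : int) :
  subshift X -> admissible X w -> exists2 x, X x & occurs_at w x i.
Proof.
move=> sX [x Xx [j xj]]; exists (translate (j - i) x).
  exact: subshift_translate.
by rewrite /occurs_at word_at_translate addrCA subrr addr0.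
Qed.

(** * Words that can follow every past ending in a given word *)

(* The point [y] stands for a left-infinite past ending in [a]: its coordinates
   beyond [a] play no role. *)
Definition follows (S : finType) (X : set (full_shift S)) (a c : seq S) : Prop :=
  forall (y : full_shift S) (i : int), X y -> occurs_at a y i ->
    exists z, [/\ X z, forall j : int, j < i + (size a)%:Z -> z j = y j &
      occurs_at c z (i + (size a)%:Z)].

(** Shift invariance reduces the test to one position, which can then be chosen to fit the windows
    of the block codes. *)
Lemma follows_at (S : finType) (X : set (full_shift S)) (a c : seq S) (i : int) :
  subshift X ->
  (forall y : full_shift S, X y -> occurs_at a y i ->
     exists z, [/\ X z, forall j : int, j < i + (size a)%:Z -> z j = y j &
       occurs_at c z (i + (size a)%:Z)]) ->
  follows X a c.
Proof.
move=> sX ac y k Xy ya.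
have [||z [Xz zy zc]] := ac (translate (k - i) y).
- exact: subshift_translate.
- by rewrite /occurs_at word_at_translate subrKC.
exists (translate (i - k) z); split; first exact: subshift_translate.
  by move=> j hj; rewrite /translate zy /translate; [congr (y _); lia|lia].
rewrite /occurs_at word_at_translate; apply: etrans zc; congr (word_at z _ _); lia.
Qed.

Lemma eq_restr (S : finType) (I : interval int) (x y : full_shift S) :
  restr (I := I) x = restr (I := I) y <-> forall j, j \in I -> x j = y j.
Proof.
split=> [xy j jI|xy]; last by apply/funext => -[j jI]; apply: xy.
exact: (congr1 (fun f => f (exist _ j jI)) xy).
Qed.

(** A past in the half-line block is the restriction of a point of [X]; conversely, writing [s]
    after the past of such a point gives a configuration to test in [omega_plus]. *)
Lemma omega_plusP (S : finType) (X : set (full_shift S)) (a : seq S) (s : S) :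
  subshift X -> omega_plus X a s <-> follows X a [:: s].
Proof.
move=> sX; split=> [aXs y i Xy yi|aXs z za zs _ [y Xy /eq_restr yz]]; last first.
  have [|w [Xw wy /occurs_at1 ws]] := aXs y (1 - (size a)%:Z) Xy.
    apply: etrans za; apply/word_at_agree => j hj.
    by apply: yz; rewrite in_itv /=; lia.
  exists w => //; apply/eq_restr => j; rewrite in_itv /= => hj.
  have [->|j1] := eqVneq j 1; first by rewrite zs -ws subrK.
  by rewrite wy; [apply: yz; rewrite in_itv /=; lia|lia].
(* Position of the last letter of [a] in [y]; translating by [k] brings it to coordinate 0. *)
pose k := i + (size a)%:Z - 1.
pose z : full_shift S := fun j => if j == 1 then s else translate k y j.
have zE j : j <= 0 -> z j = translate k y j by rewrite /z; case: eqP => //; lia.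
have z0 I : (forall j, j \in I -> j <= 0) -> block X (restr (I := I) z).
  move=> I0; exists (translate k y); first exact: subshift_translate.
  by apply/eq_restr => j /I0 /zE.
have [||||w Xw /eq_restr wz] := aXs z.
- apply: etrans yi; rewrite (_ : i = 1 - (size a)%:Z + k); last by rewrite /k; lia.
  by rewrite -(word_at_translate y); apply/word_at_agree => j hj; apply: zE; lia.
- by rewrite /z eqxx.
- by apply: z0 => j; rewrite in_itv /=; lia.
- by apply: z0 => j; rewrite in_itv.
exists (translate (- k) w); split; first exact: subshift_translate.
- move=> j hj; rewrite /translate wz ?in_itv /=; last by rewrite /k; lia.
  by rewrite zE /translate ?subrK // /k; lia.
- apply/occurs_at1; rewrite /translate wz ?in_itv /=; last by rewrite /k; lia.
  by rewrite /z ifT // /k; apply/eqP; lia.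
Qed.

Lemma follows_catl (S : finType) (X : set (full_shift S)) (b a c : seq S) :
  follows X a c -> follows X (b ++ a) c.
Proof.
move=> ac y i Xy /occurs_at_cat[_ ya]; have := ac _ _ Xy ya.
by rewrite size_cat PoszD addrA.
Qed.

(** The continuation by [c] is itself a past ending in [a ++ c], and appending [d] leaves it
    unchanged. *)
Lemma follows_cat (S : finType) (X : set (full_shift S)) (a c d : seq S) :
  follows X a c -> follows X (a ++ c) d -> follows X a (c ++ d).
Proof.
move=> ac acd y i Xy ya; have [z [Xz zy zc]] := ac _ _ Xy ya.
have [|w [Xw wz wd]] := acd z i Xz.
  apply/occurs_at_cat; split=> //; apply: etrans ya.
  by apply/word_at_agree => j hj; apply: zy; lia.
rewrite size_cat PoszD addrA in wz wd.
exists w; split=> // [j hj|]; first by rewrite wz ?zy //; lia.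
apply/occurs_at_cat; split=> //; apply: etrans zc.
by apply/word_at_agree => j hj; apply: wz; lia.
Qed.

Lemma property_D_word (S : finType) (X : set (full_shift S)) (b c : seq S) :
  subshift X -> property_D X -> admissible X (b ++ c) ->
  exists2 a, admissible X (a ++ b) & follows X (a ++ b) c.
Proof.
move=> sX XD; elim/last_ind: c b => [|c s IH] b bc.
  exists [::]; first by rewrite cats0 in bc.
  move=> y i Xy _; exists y; split=> //.
(* The last letter is treated first: its prefix [a] is absorbed into [b] before the induction
   hypothesis, and the later prefix [a'] is harmless by [follows_catl]. *)
have [a abc abcs] : exists2 a,
    Gamma_minus X (b ++ c) a & omega_plus X (a ++ b ++ c) s.
  by apply: XD; rewrite rcons_cat.
have [|a' a'ab a'c] := IH (a ++ b); first by rewrite -catA.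
exists (a' ++ a); first by rewrite -catA.
rewrite -cats1 -catA; apply: follows_cat => //.
by rewrite -!catA; apply: follows_catl; apply/omega_plusP.
Qed.

(** * Transfer of property (D) along a conjugacy *)

Theorem proposition4p3 (Sigma Sigma' : finType)
    (X : set (full_shift Sigma)) (X' : set (full_shift Sigma'))
    (hX : subshift X) (hX' : subshift X')
    (hconj : conjugate X X') (hD : property_D X') :
  property_D X.
Proof.
move: hconj => [phi [psi [cphi cpsi phiK psiK phiC]]] b s.
(* The inverse inherits the commutation: [v] is the image under [phi] of the shift of [psi u]. *)
have psiC (u v : X') : set_val v = Defs.shift (set_val u) ->
    set_val (psi v) = Defs.shift (set_val (psi u)).
  move=> uv.
  have [w wE] := translate_lift 1 (psi u) hX.
  suff -> : v = phi w by rewrite phiK.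
  by apply/val_inj; rewrite -!set_valE uv (phiC (psi u)) ?psiK.
have [n1 phin] := sliding_block_code hX cphi phiC.
have [n2 psin] := sliding_block_code hX' cpsi psiC.
pose L := maxn n1 n2.
have phiL (u v : X) i :
    (forall j, i - L%:Z <= j <= i + L%:Z -> set_val u j = set_val v j) ->
    set_val (phi u) i = set_val (phi v) i.
  by move=> uv; apply: phin => j hj; apply: uv; lia.
have psiL (u v : X') i :
    (forall j, i - L%:Z <= j <= i + L%:Z -> set_val u j = set_val v j) ->
    set_val (psi u) i = set_val (psi v) i.
  by move=> uv; apply: psin => j hj; apply: uv; lia.
move=> bs; have [_ /(@set_val_surj _ X)[x <-]] := admissible_at 0 hX bs.
rewrite -cats1 => /occurs_at_cat[xb /occurs_at1 xs].
rewrite add0r in xs; set m := size b in xs *.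
pose x' := set_val (phi x).
pose b' := word_at x' (- (3 * L)%:Z) (2 * L + m).
pose c' := word_at x' (m%:Z - L%:Z) (2 * L).+1.
have [|a' a'b' a'c'] := @property_D_word _ X' b' c' hX' hD.
  exists x'; first exact: set_valP.
  exists (- (3 * L)%:Z); apply/occurs_at_cat; split; first exact/occurs_at_word_at.
  by rewrite /occurs_at !size_word_at; congr (word_at x' _ _); lia.
(* With [a'] starting at [p], the word [b'] falls on its original place, at -3L. *)
pose p : int := - (3 * L)%:Z - (size a')%:Z.
have [y0 X'y0 y0ab] := admissible_at p hX' a'b'.
have [_ [/(@set_val_surj _ X')[z' <-] z'y0 z'c]] := a'c' _ _ X'y0 y0ab.
have size_ab' : (size (a' ++ b') = size a' + (2 * L + m))%N.
  by rewrite size_cat size_word_at.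
rewrite size_ab' in z'y0 z'c.
have z'ab : occurs_at (a' ++ b') (set_val z') p.
  apply: etrans y0ab; apply/word_at_agree => j; rewrite size_ab' => hj.
  by apply: z'y0; lia.
have context w : occurs_at (a' ++ b') w p ->
    occurs_at c' w (p + (size a' + (2 * L + m))%N%:Z) ->
    forall j, - (3 * L)%:Z <= j <= m%:Z + L%:Z -> w j = x' j.
  move=> /occurs_at_cat[_ wb] wc j hj.
  have [jm|mj] := ltP j (m%:Z - L%:Z).
    rewrite (_ : p + _ = - (3 * L)%:Z) in wb; last by rewrite /p; lia.
    by move/occurs_at_word_at : wb; apply; lia.
  rewrite (_ : p + _ = m%:Z - L%:Z) in wc; last by rewrite /p; lia.
  by move/occurs_at_word_at : wc; apply; lia.
(* Applied twice: to [z'], and to the modified image of [y]. *)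
have psi_context (w : X') : occurs_at (a' ++ b') (set_val w) p ->
    occurs_at c' (set_val w) (p + (size a' + (2 * L + m))%N%:Z) ->
    forall j, - (2 * L)%:Z <= j <= m%:Z -> set_val (psi w) j = set_val x j.
  move=> wab wc j hj; rewrite -(phiK x); apply: psiL => k hk.
  by apply: context => //; lia.
pose z := set_val (psi z').
have zx : forall j, - (2 * L)%:Z <= j <= m%:Z -> z j = set_val x j.
  exact: psi_context z'ab z'c.
(* As p - L = -4L - |a'|, the word [a] ends just before 0, and [a ++ b] fills [p-L, m[, the
   L-neighbourhood of the place [p, m-L[ of [a' ++ b']. *)
pose a := word_at z (p - L%:Z) (size a' + 4 * L).
have abE : a ++ b = word_at z (p - L%:Z) (size a' + 4 * L + m).
  rewrite word_at_cat; congr (_ ++ _); rewrite -[LHS]xb.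
  rewrite (_ : p - _ + _ = 0); last by rewrite /p; lia.
  by apply/word_at_agree => j hj; rewrite zx //; lia.
exists a.
  exists z; first exact: set_valP.
  by exists (p - L%:Z); rewrite abE size_word_at.
apply/omega_plusP => //; apply: (@follows_at _ _ _ _ (p - L%:Z)) => //.
rewrite abE size_word_at => _ /(@set_val_surj _ X)[y <-] /occurs_at_word_at yz.
have phiy_ab : occurs_at (a' ++ b') (set_val (phi y)) p.
  apply: etrans z'ab; apply/word_at_agree => j; rewrite size_ab' => hj.
  rewrite -(psiK z'); apply: phiL => k hk; apply: yz.
  by move: hj hk; rewrite /p; lia.
have [_ [/(@set_val_surj _ X')[w <-] wy wc]] := a'c' _ _ (set_valP _) phiy_ab.
rewrite size_ab' in wy wc.
have wab : occurs_at (a' ++ b') (set_val w) p.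
  apply: etrans phiy_ab; apply/word_at_agree => j; rewrite size_ab' => hj.
  by apply: wy; lia.
have wx := psi_context w wab wc.
exists (set_val (psi w)); split; first exact: set_valP.
  (* Left of m-2L the window of [psi] stays left of m-L, where [w] is the image of [y]. On [m-2L,
     m[, which lies in [-2L, m] even for empty [b], both sides equal [x]. *)
  move=> j; rewrite /p => hj; have [jL|jL] := ltP j (m%:Z - (2 * L)%:Z).
    rewrite -[in RHS](phiK y); apply: psiL => k hk; apply: wy.
    by rewrite /p; lia.
  rewrite wx; last by lia.
  by rewrite yz ?zx //; rewrite /p; lia.
apply/occurs_at1; rewrite (_ : p - _ + _ = m%:Z); last by rewrite /p; lia.
by rewrite wx //; lia.
Qed.
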